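(* Let $A$ be a commutative group, $L$ a loop with the left inverse property with identity $\epsilon$, and let $\Sigma=\{(\xi,\epsilon):\xi\in L\}\cup\{(\epsilon,\xi):\xi\in L\}\cup\{(\xi^{-1},\xi):\xi\in L\}\subset L\times L$. Consider the following conditions on maps $P,Q:L\times L\to\mathrm{Aut}(A)$: (i) On $\Sigma$: $P(\xi,\epsilon)=\mathrm{Id}$ and $Q(\epsilon,\xi)=\mathrm{Id}$ for all $\xi\in L$; the values $P(\epsilon,\xi)$, $\xi\neq\epsilon$, are arbitrary; $Q(\xi^{-1},\xi)=Q(\xi,\epsilon)^{-1}=q(\xi)$ for all $\xi\in L$, where $q:L\to\mathrm{Aut}(A)$ is an arbitrary map with $q(\epsilon)=\mathrm{Id}$; and $P(\xi^{-1},\xi)=p(\xi)$ for all $\xi\in L$, where $p:L\to\mathrm{Aut}(A)$ is a map satisfying $p(\xi^{-1})=q(\xi^{-1})p(\xi)^{-1}q(\xi)$ for all $\xi\in L$. (ii) For all $(\xi,\eta)\in(L\times L)\setminus\Sigma$: $$Q(\xi^{-1},\xi\eta)=Q(\xi,\eta)^{-1},\qquad P(\xi^{-1},\xi\eta)=Q(\xi,\eta)^{-1}P(\xi,\eta)\,Q(\xi^{-1},\xi)^{-1}P(\xi^{-1},\xi).$$ Every linear abelian extension $F(P,Q)$ of $A$ by $L$ determined by maps $P,Q$ satisfying (i) and (ii) has the left inverse property. Conversely, every linear abelian extension $F(P,Q)$ of $A$ by $L$ having the left inverse property fulfills (i) and (ii).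
   Context: A loop is a set with a binary multiplication having a two-sided identity element such that all left and right translations are bijections. A loop $L$ has the left inverse property if there is a bijection $\iota:L\to L$ with $\iota(x)\cdot xy=y$ for all $x,y\in L$; then left and right inverses of every $x$ coincide and $\iota(x)=x^{-1}$. Let $A=(A,+)$ be a commutative group and $L$ a loop with identity $\epsilon$. A loop cocycle is a pair $(P,Q)$ of maps $P,Q:L\times L\to\mathrm{Aut}(A)$ with $P(\alpha,\epsilon)=\mathrm{Id}=Q(\epsilon,\beta)$ for all $\alpha,\beta\in L$. The linear abelian extension $F(P,Q)$ of $A$ by $L$ determined by the cocycle $(P,Q)$ is the loop on $L\times A$ with multiplication $(\alpha,a)\cdot(\beta,b)=(\alpha\beta,\,P(\alpha,\beta)a+Q(\alpha,\beta)b)$ and identity $(\epsilon,0)$. *)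

(* Defs.v *)
From HB Require Import structures.
From mathcomp Require Import all_boot all_algebra.
From mathcomp Require Import boolp classical_sets.

Set Implicit Arguments.
Unset Strict Implicit.
Unset Printing Implicit Defensive.

Import GRing.Theory.
Local Open Scope group_scope.
Local Open Scope classical_set_scope.

HB.mixin Record UMagma_isLoop L of UMagma L := {
  ltrans_bij : forall x : L, bijective (fun y : L => x * y);
  rtrans_bij : forall x : L, bijective (fun y : L => y * x)
}.

#[short(type="loopType")]
HB.structure Definition Loop := {L of UMagma_isLoop L & UMagma L}.

Definition lip_map (L : loopType) (inv : L -> L) : Prop :=
  bijective inv /\ forall x y : L, inv x * (x * y) = y.

Definition left_inverse_property (L : loopType) : Prop :=
  exists inv : L -> L, lip_map inv.

(* A map witnessing the left inverse property is unique, and is the two-sided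
   inversion of the loop. *)
Section LipMap.
Variables (L : loopType) (inv : L -> L).
Hypothesis inv_lip : lip_map inv.

Lemma lip_mulVg x : inv x * x = 1.
Proof. by have := inv_lip.2 x 1; rewrite mulg1. Qed.

Lemma lip_invK : involutive inv.
Proof.
by move=> x; have := inv_lip.2 (inv x) x; rewrite lip_mulVg mulg1.
Qed.

Lemma lip_mulgV x : x * inv x = 1.
Proof. by rewrite -{1}(lip_invK x) lip_mulVg. Qed.

End LipMap.

Lemma lip_map_unique (L : loopType) (i j : L -> L) :
  lip_map i -> lip_map j -> i =1 j.
Proof.
move=> hi hj x; have [g gK _] := rtrans_bij x.
by rewrite -(gK (i x)) -(gK (j x)) !lip_mulVg.
Qed.

Record addAut (A : zmodType) := AddAut {
  addAut_fun :> {additive A -> A};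
  addAut_bij : bijective addAut_fun
}.

Section AddAutGroup.
Variable A : zmodType.
Implicit Types f g h : addAut A.

HB.instance Definition _ := gen_eqMixin (addAut A).
HB.instance Definition _ := gen_choiceMixin (addAut A).

Lemma addAutP f g : f =1 g -> f = g.
Proof.
case: f => [[f [[mf]]] fb]; case: g => [[g [[mg]]] gb] /= /funext efg.
case: _ / efg in mg gb *.
by rewrite (Prop_irrelevance mg mf) in gb *; rewrite (Prop_irrelevance gb fb).
Qed.

Lemma idfun_bij : bijective (idfun : {additive A -> A}).
Proof. by exists idfun. Qed.

Definition addAut_one : addAut A := AddAut idfun_bij.

Lemma addAut_comp_bij f g : bijective (f \o g : {additive A -> A}).
Proof. by apply: bij_comp; apply: addAut_bij. Qed.

Definition addAut_mul f g : addAut A := AddAut (addAut_comp_bij f g).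

Lemma addAut_inv_ex f : exists f' : A -> A, cancel f f' /\ cancel f' f.
Proof. by have [f' fK f'K] := addAut_bij f; exists f'. Qed.

Definition addAut_inv_fun f : A -> A := sval (cid (addAut_inv_ex f)).

Lemma addAut_funK f : cancel f (addAut_inv_fun f).
Proof. by rewrite /addAut_inv_fun; case: cid => f' []. Qed.

Lemma addAut_inv_funK f : cancel (addAut_inv_fun f) f.
Proof. by rewrite /addAut_inv_fun; case: cid => f' []. Qed.

Lemma addAut_inv_fun_zmod f : zmod_morphism (addAut_inv_fun f).
Proof.
move=> a b; apply: (can_inj (addAut_funK f)).
by rewrite raddfB !addAut_inv_funK.
Qed.

HB.instance Definition _ f :=
  GRing.isZmodMorphism.Build A A (addAut_inv_fun f) (@addAut_inv_fun_zmod f).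

Lemma addAut_inv_bij f : bijective (addAut_inv_fun f : {additive A -> A}).
Proof. by exists f; [apply: addAut_inv_funK | apply: addAut_funK]. Qed.

Definition addAut_inv f : addAut A := AddAut (addAut_inv_bij f).

Lemma addAut_mulA : associative addAut_mul.
Proof. by move=> f g h; apply: addAutP. Qed.

Lemma addAut_mul1 : left_id addAut_one addAut_mul.
Proof. by move=> f; apply: addAutP. Qed.

Lemma addAut_mulr1 : right_id addAut_one addAut_mul.
Proof. by move=> f; apply: addAutP. Qed.

Lemma addAut_mulV : left_inverse addAut_one addAut_inv addAut_mul.
Proof. by move=> f; apply: addAutP => a; apply: addAut_funK. Qed.

Lemma addAut_mulrV : right_inverse addAut_one addAut_inv addAut_mul.
Proof. by move=> f; apply: addAutP => a; apply: addAut_inv_funK. Qed.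

HB.instance Definition _ := isGroup.Build (addAut A)
  addAut_mulA addAut_mul1 addAut_mulr1 addAut_mulV addAut_mulrV.

Lemma addAut1E a : (1 : addAut A) a = a. Proof. by []. Qed.

Lemma addAutME f g a : (f * g) a = f (g a). Proof. by []. Qed.

Lemma addAutK f : cancel f f^-1. Proof. exact: addAut_funK. Qed.

Lemma addAutVK f : cancel f^-1 f. Proof. exact: addAut_inv_funK. Qed.

End AddAutGroup.

Section LinearExtension.
Variables (A : zmodType) (L : loopType).

Definition loop_cocycle (P Q : L -> L -> addAut A) : Prop :=
  (forall x, P x 1 = 1) /\ (forall y, Q 1 y = 1).

(* The loop F(P,Q); the cocycle proof [c] only serves to key the loop
   structure. *)
Definition lin_ext (P Q : L -> L -> addAut A) (c : loop_cocycle P Q) : Type :=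
  (L * A)%type.

Variables (P Q : L -> L -> addAut A) (c : loop_cocycle P Q).
Local Notation F := (lin_ext c).

HB.instance Definition _ := Choice.copy F (L * A)%type.

Definition lin_ext_one : F := (1, 0%R).

Definition lin_ext_mul (u v : F) : F :=
  (u.1 * v.1, (P u.1 v.1 u.2 + Q u.1 v.1 v.2)%R).

Lemma lin_ext_mul1 : left_id lin_ext_one lin_ext_mul.
Proof. by case=> x a; rewrite /lin_ext_mul /= mul1g raddf0 c.2 add0r. Qed.

Lemma lin_ext_mulr1 : right_id lin_ext_one lin_ext_mul.
Proof. by case=> x a; rewrite /lin_ext_mul /= mulg1 raddf0 c.1 addr0. Qed.

HB.instance Definition _ := hasMul.Build F lin_ext_mul.
HB.instance Definition _ :=
  Magma_isUMagma.Build F lin_ext_mul1 lin_ext_mulr1.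

Lemma lin_ext_ltrans_bij (u : F) : bijective (fun v : F => u * v).
Proof.
case: u => x a; have [g gK Kg] := ltrans_bij x.
exists (fun w : F => (g w.1, (Q x (g w.1))^-1 (w.2 - P x (g w.1) a)%R) : F).
  by case=> y b; congr pair => /=; rewrite !gK // [X in (X - _)%R]addrC addrK addAutK.
by case=> z d; congr pair => /=; rewrite ?Kg // addAutVK addrC subrK.
Qed.

Lemma lin_ext_rtrans_bij (u : F) : bijective (fun v : F => v * u).
Proof.
case: u => y b; have [g gK Kg] := rtrans_bij y.
exists (fun w : F => (g w.1, (P (g w.1) y)^-1 (w.2 - Q (g w.1) y b)%R) : F).
  by case=> x a; congr pair => /=; rewrite !gK // addrK addAutK.
by case=> z d; congr pair => /=; rewrite ?Kg // addAutVK subrK.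
Qed.

HB.instance Definition _ :=
  UMagma_isLoop.Build F lin_ext_ltrans_bij lin_ext_rtrans_bij.

End LinearExtension.

Definition Sigma (L : loopType) (inv : L -> L) : set (L * L) :=
  [set (xi, 1) | xi in [set: L]] `|` [set (1, xi) | xi in [set: L]]
    `|` [set (inv xi, xi) | xi in [set: L]].

Section Conditions.
Variables (A : zmodType) (L : loopType) (inv : L -> L).

(* The values of q are arbitrary off the identity, and those of P 1 xi are
   arbitrary for xi <> 1: neither is constrained here. *)
Definition condition_i (P Q : L -> L -> addAut A) : Prop :=
  (forall xi, P xi 1 = 1 /\ Q 1 xi = 1) /\
  exists q p : L -> addAut A,
    [/\ q 1 = 1,
        forall xi, Q (inv xi) xi = (Q xi 1)^-1 /\ (Q xi 1)^-1 = q xi,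
        forall xi, P (inv xi) xi = p xi
      & forall xi, p (inv xi) = q (inv xi) * (p xi)^-1 * q xi].

Definition condition_ii (P Q : L -> L -> addAut A) : Prop :=
  forall xi eta, ~ Sigma inv (xi, eta) ->
    Q (inv xi) (xi * eta) = (Q xi eta)^-1 /\
    P (inv xi) (xi * eta) =
      (Q xi eta)^-1 * P xi eta * (Q (inv xi) xi)^-1 * P (inv xi) xi.

End Conditions.

(* Main.v *)
Require Import Defs.
From mathcomp Require Import all_boot all_algebra.
From mathcomp Require Import boolp classical_sets.

(** The first coordinate of a left inverse of [(x, a)] in [F(P,Q)] must be
    [inv x], and solving [(inv x, j) * (x, a) = (1, 0)] for [j] leaves only
    [j = - (P (inv x) x)^-1 (Q (inv x) x a)].  Hence there is a single candidate
    for the inversion of [F(P,Q)], and the left inverse property says that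
    [(inv x, j) * ((x, a) * (y, b))] has second coordinate [b].  That
    coordinate is additive in [a] and in [b] separately; comparing the
    coefficients of [b] and of [a] gives
    - [Q (inv x) (x * y) = (Q x y)^-1], and
    - [P (inv x) (x * y)
         = (Q x y)^-1 * P x y * (Q (inv x) x)^-1 * P (inv x) x],

    for every pair [(x, y)].  This equivalence is the content of
    [lip_equations_lip] and [lip_lip_equations].

    Condition (ii) states these two equations off [Sigma], so it remains to see
    what they say on [Sigma], knowing that [P x 1 = 1] and [Q 1 y = 1].  At
    [(x, 1)] they both reduce to [Q (inv x) x = (Q x 1)^-1]; at [(1, y)] they
    are trivial; at [(inv x, x)] the first one repeats the case [(x, 1)], and
    the second one, whose left-hand side is [P x 1 = 1], is the relation imposed
    on [p].  This is condition (i), with [q x = Q (inv x) x] and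
    [p x = P (inv x) x]. *)

Set Implicit Arguments.
Unset Strict Implicit.
Unset Printing Implicit Defensive.

Import GRing.Theory.
Local Open Scope group_scope.

Section LeftInverseExtension.
Variables (A : zmodType) (L : loopType) (inv : L -> L).
Hypothesis inv_lip : lip_map inv.

Lemma lip_inv1 : inv 1 = 1.
Proof. by rewrite -[LHS]mulg1 (lip_mulVg inv_lip). Qed.

(** Condition (ii) extended to the pairs in [Sigma]: this uniform system is what
    the left inverse property of [F(P,Q)] amounts to. *)
Definition lip_equations (P Q : L -> L -> addAut A) : Prop :=
  forall x y,
    Q (inv x) (x * y) = (Q x y)^-1 /\
    P (inv x) (x * y) = (Q x y)^-1 * P x y * (Q (inv x) x)^-1 * P (inv x) x.

Section Extension.
Variables (P Q : L -> L -> addAut A) (c : loop_cocycle P Q).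
Local Notation F := (lin_ext c).

Definition lin_ext_inv_coef x : addAut A := (P (inv x) x)^-1 * Q (inv x) x.

(** The only possible inversion of [F(P,Q)]: see [lip_map_lin_ext_inv]. *)
Definition lin_ext_inv (u : F) : F :=
  (inv u.1, (- lin_ext_inv_coef u.1 u.2)%R).

Lemma lin_ext_inv_bij : bijective lin_ext_inv.
Proof.
pose T := lin_ext_inv_coef.
exists (fun w : F => (inv w.1, (T (inv w.1))^-1 (- w.2)%R) : F) => -[x a].
  by rewrite /lin_ext_inv /= (lip_invK inv_lip) opprK addAutK.
rewrite -[LHS]/(inv (inv x), (- T (inv x) ((T (inv x))^-1%g (- a)))%R).
by rewrite (lip_invK inv_lip) addAutVK opprK.
Qed.

(** Right translations of a loop are injective, so [u] has only one left
    inverse, and [lin_ext_inv_coef] is chosen so that [lin_ext_inv u] is one. *)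
Lemma lip_map_lin_ext_inv (i : F -> F) : lip_map i -> i =1 lin_ext_inv.
Proof.
move=> i_lip u; have iVu := lip_mulVg i_lip u.
have [g gK _] := rtrans_bij u.
rewrite -(gK (i u)) -(gK (lin_ext_inv u)) iVu; congr g.
case: u {iVu gK} => x a; congr pair => /=; first by rewrite (lip_mulVg inv_lip).
by rewrite raddfN addAut_inv_funK addNr.
Qed.

Lemma lin_ext_inv_mul2 x y a b :
  (lin_ext_inv (x, a) * (((x, a) : F) * ((y, b) : F))).2 =
  (- (P (inv x) (x * y) * (P (inv x) x)^-1 * Q (inv x) x)%g a
   + ((Q (inv x) (x * y) * P x y)%g a + (Q (inv x) (x * y) * Q x y)%g b))%R.
Proof. by rewrite /= !(raddfN, raddfD). Qed.

Lemma lip_equations_lip : lip_equations P Q -> left_inverse_property F.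
Proof.
move=> PQ; exists lin_ext_inv; split; first exact: lin_ext_inv_bij.
case=> x a [y b]; rewrite [LHS]surjective_pairing lin_ext_inv_mul2.
congr pair; first exact: inv_lip.2.
have [-> ->] := PQ x y.
by rewrite mulgK mulgVK mulVg addKr.
Qed.

(** Both equations come from one identity between additive expressions in [a]
    and [b], specialized at [a = 0] and at [b = 0]. *)
Lemma lip_lip_equations : left_inverse_property F -> lip_equations P Q.
Proof.
case=> i i_lip x y.
have lipE a b := f_equal snd (i_lip.2 ((x, a) : F) ((y, b) : F)).
have {}lipE a b :
    (- (P (inv x) (x * y) * (P (inv x) x)^-1 * Q (inv x) x)%g a
     + ((Q (inv x) (x * y) * P x y)%g a + (Q (inv x) (x * y) * Q x y)%g b))%R = b.
  by rewrite -lin_ext_inv_mul2 -(lip_map_lin_ext_inv i_lip) lipE.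
(* The coefficient of b, read off at a = 0. *)
have QQ : Q (inv x) (x * y) * Q x y = 1.
  by apply: addAutP => b; have := lipE 0%R b; rewrite !raddf0 !add0r.
have QE : Q (inv x) (x * y) = (Q x y)^-1.
  by rewrite -[LHS](mulgK (Q x y)) QQ mul1g.
(* The coefficient of a, read off at b = 0. *)
have PQE : P (inv x) (x * y) * (P (inv x) x)^-1 * Q (inv x) x
           = (Q x y)^-1 * P x y.
  apply: addAutP => a; have /eqP := lipE a 0%R.
  by rewrite raddf0 addr0 addrC subr_eq0 QE => /eqP.
by split=> //; rewrite -PQE mulgK mulgVK.
Qed.

End Extension.

(** At the pairs [(inv z, z)] of [Sigma], the equation for [P] is exactly the relation
    between [p (inv z)] and [p z]; the rest of [Sigma] needs only the values of
    [P] and [Q] at the identity and [Q (inv z) z = (Q z 1)^-1]. *)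
Lemma conditions_lip_equations (P Q : L -> L -> addAut A) :
  condition_i inv P Q -> condition_ii inv P Q -> lip_equations P Q.
Proof.
case=> PQ1 [q [p [q1 Qq Pp pV]]] PQii x y.
have QV z : Q (inv z) z = (Q z 1)^-1 by have [] := Qq z.
have Qqz z : Q (inv z) z = q z by have [-> ->] := Qq z.
have [[[[z _ [<- <-]]|[z _ [<- <-]]]|[z _ [<- <-]]]|/PQii//] :=
  pselect (Sigma inv (x, y)).
- by rewrite mulg1 QV (PQ1 z).1 mulg1 invgK mulVg mul1g.
- rewrite lip_inv1 mul1g !(PQ1 _).2 (PQ1 1).1 invg1.
  by rewrite mul1g !mulg1.
- rewrite (lip_invK inv_lip) (lip_mulVg inv_lip) (PQ1 z).1.
  have Qz : Q z (inv z) = q (inv z) by rewrite -Qqz (lip_invK inv_lip).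
  have Pz : P z (inv z) = p (inv z) by rewrite -Pp (lip_invK inv_lip).
  split; first by rewrite QV invgK.
  by rewrite Qz Pz Qqz Pp pV !mulgA mulgVK mulgK mulVg.
Qed.

Lemma lip_equations_conditions (P Q : L -> L -> addAut A) :
  loop_cocycle P Q -> lip_equations P Q ->
  condition_i inv P Q /\ condition_ii inv P Q.
Proof.
case=> P1 Q1 PQ; split=> [|x y _]; last exact: PQ.
have QV x : Q (inv x) x = (Q x 1)^-1 by have [] := PQ x 1; rewrite mulg1.
split=> [x //|]; exists (fun x => Q (inv x) x), (fun x => P (inv x) x).
split=> [||//|x]; [by rewrite lip_inv1 Q1 | by move=> x; rewrite QV |].
(* The second equation at (inv x, x), whose left-hand side is P x 1 = 1. *)
have [_] := PQ (inv x) x.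
rewrite (lip_invK inv_lip) (lip_mulVg inv_lip) P1 => PE.
by rewrite -[RHS]mulg1 PE !mulgA mulgK mulgVK mulgV mul1g.
Qed.

End LeftInverseExtension.

Theorem corollary6 (A : zmodType) (L : loopType) (inv : L -> L)
    (inv_lip : lip_map inv) :
  (forall P Q : L -> L -> addAut A,
     condition_i inv P Q -> condition_ii inv P Q ->
     exists c : loop_cocycle P Q, left_inverse_property (lin_ext c)) /\
  (forall (P Q : L -> L -> addAut A) (c : loop_cocycle P Q),
     left_inverse_property (lin_ext c) ->
     condition_i inv P Q /\ condition_ii inv P Q).
Proof.
split=> [P Q PQi PQii|P Q c F_lip].
  have c : loop_cocycle P Q by split=> x; have [] := PQi.1 x.
  exists c; apply: (lip_equations_lip inv_lip).
  exact: (conditions_lip_equations inv_lip PQi PQii).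
exact: (lip_equations_conditions inv_lip c (lip_lip_equations inv_lip F_lip)).
Qed.
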